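(* Let $P_{RS}$ be a componentwise random scan accept-reject-based (ARB-RS) Markov kernel on $\Omega=\prod_{k=1}^M\Omega^k$ for the target $\Pi$ supported on $\Theta=\prod_{k=1}^M\Theta^k$, with selection probabilities $\lambda_1,\dots,\lambda_M$ and componentwise acceptance probabilities $A_{\theta^{(-k)}}(\cdot)$. For any $\theta=(\theta^1,\dots,\theta^M)\in\Theta$ and every positive integer $t$, $$\|P_{RS}^t(\theta,\cdot)-\Pi\|_{\mathrm{TV}}\ \ge\ \left[1-\sum_{k=1}^M\lambda_kA_{\theta^{(-k)}}(\theta^k)\right]^t.$$
   Context: $\Omega=\prod_{k=1}^M\Omega^k$ is a nonempty Borel measurable space with Borel sigma-algebra $\mathcal{B}(\Omega)$. $\Pi$ is a probability measure on it, supported on a nonempty measurable set $\Theta=\prod_{k=1}^M\Theta^k\subseteq\Omega$, with density $\pi$ with respect to a sigma-finite measure $\lambda$; the support of $\pi$ is $\Theta$, so $\pi>0$ on $\Theta$. For each $\theta\in\Theta$, $\{\theta\}$ is Borel measurable with $\lambda(\{\theta\})=0$, and $\lambda(U)>0$ for all nonempty measurable open sets $U\subseteq\Theta$. For $k=1,\dots,M$, $\theta^{(-k)}$ denotes the components $\{\theta^1,\dots,\theta^M\}\setminus\{\theta^k\}$; $\Pi_{\theta^{(-k)}}$ is the full conditional distribution of the $k$th component, with density $\theta^k\mapsto\pi_{\theta^{(-k)}}(\theta^k)$. ARB kernel (on a generic space with reference measure $\nu$): given proposal densities $q(x,\cdot)$ with respect to $\nu$ and an acceptance function $a(x,x')\in[0,1]$,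 the acceptance probability is $A(x)=\int a(x,x')q(x,x')\,d\nu(x')$ and the kernel is $P(x,B)=\int_Ba(x,x')q(x,x')\,d\nu(x')+\delta_x(B)[1-A(x)]$, where $a$ is such that the target distribution is invariant. For each $k$, $P_{\theta^{(-k)}}$ is an ARB kernel on $\Omega^k$ with invariant distribution $\Pi_{\theta^{(-k)}}$, proposal $Q_{\theta^{(-k)}}$ (which may depend on $\theta^{(-k)}$), and acceptance probability $A_{\theta^{(-k)}}(\cdot)$. The full conditional may be used as a proposal (a Gibbs update), but at least one of the updates is an ARB kernel that is not a Gibbs update. Let $\lambda_k\in(0,1)$ be the selection probability of the $k$th component, $\sum_{k=1}^M\lambda_k=1$. For $\theta=(\theta^1,\dots,\theta^M)\in\Omega$ and $B=\prod_{k=1}^MB^k$ with measurable $B^k\subseteq\Omega^k$, $$P_{RS}(\theta,B)=\sum_{k=1}^M\lambda_k\left\{P_{\theta^{(-k)}}(\theta^k,B^k)\prod_{j\ne k}\delta_{\theta^j}(B^j)\right\},$$ and $P_{RS}^t$ is its $t$-step kernel. Total variation: $\|\mu-\nu\|_{\mathrm{TV}}=\sup_f\left[\int f\,d\mu-\int f\,d\nu\right]$ over Borel measurable $f:\Omega\to[0,1]$. *)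

(* Defs.v *)
From HB Require Import structures.
From mathcomp Require Export all_boot all_order all_algebra.
From mathcomp Require Export all_classical all_reals all_analysis.
Export Order.TTheory GRing.Theory Num.Theory.
Export numFieldNormedType.Exports.

Set Implicit Arguments.
Unset Strict Implicit.
Unset Printing Implicit Defensive.

Local Open Scope classical_set_scope.
Local Open Scope ring_scope.

HB.instance Definition _ (I : Type) (T : I -> ptopologicalType) :=
  Pointed.copy (prod_topology T) (forall i, T i).

(* On [prod_space] below this is the Borel sigma-algebra of the product topology;
   it contains, possibly strictly, the product of the Borel sigma-algebras. *)
Notation borel T := (g_sigma_algebraType (@open T)).

Section product_space.
Context (M : nat) (Omega : 'I_M -> ptopologicalType).

Definition prod_space : ptopologicalType := prod_topology Omega.

Definition compl_space (k : 'I_M) : ptopologicalType :=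
  prod_topology (fun j : {j : 'I_M | j != k} => Omega (val j)).

(* theta ^(-k) *)
Definition drop_comp (k : 'I_M) (theta : prod_space) : compl_space k :=
  fun j => theta (val j).

Definition rectangle (B : forall k, set (Omega k)) : set prod_space :=
  [set theta : prod_space | forall k, B k (theta k)].

End product_space.

Arguments drop_comp {M Omega} k theta.

Section densities_and_kernels.
Context d (T : measurableType d) (R : realType).
Implicit Types mu nu : {measure set T -> \bar R}.

Definition has_density nu mu (f : T -> R) : Prop :=
  [/\ measurable_fun setT f, (forall x, 0 <= f x) &
      forall B, measurable B -> mu B = (\int[nu]_(x in B) (f x)%:E)%E].

Definition invariant_measure mu (P : R.-pker T ~> T) : Prop :=
  forall B, measurable B -> (\int[mu]_x P x B = mu B)%E.

Definition accept_prob nu (q a : T -> T -> R) (x : T) : R :=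
  \int[nu]_x' (a x x' * q x x').

(* Invariance of the target is not included: it is [invariant_measure]. *)
Record arb_kernel nu (Q : R.-pker T ~> T) (q a : T -> T -> R)
    (P : R.-pker T ~> T) : Prop := {
  arb_density : forall x, has_density nu (Q x) (q x) ;
  arb_accept_measurable : forall x, measurable_fun setT (a x) ;
  arb_accept01 : forall x x', 0 <= a x x' <= 1 ;
  arb_kernelE : forall x B, measurable B ->
    P x B = (\int[nu]_(x' in B) (a x x' * q x x')%:E
             + \d_x B * (1 - accept_prob nu q a x)%:E)%E }.

(* A Gibbs update proposes from the full conditional mu and always accepts. *)
Definition gibbs_update nu mu (Q : R.-pker T ~> T) (q a : T -> T -> R) : Prop :=
  forall x, (forall B, measurable B -> Q x B = mu B) /\
            accept_prob nu q a x = 1.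

(* The t-step kernel P^t. The library only equips compositions with a
   sub-probability kernel structure, hence the codomain. *)
Fixpoint kernel_iter (P : R.-pker T ~> T) (t : nat) : R.-spker T ~> T :=
  if t is t'.+1 then mkcomp_noparam P (kernel_iter P t')
  else kdirac (@measurable_id _ T setT).

Definition tv_dist mu nu : \bar R :=
  ereal_sup [set (\int[mu]_x (f x)%:E - \int[nu]_x (f x)%:E)%E |
    f in [set f : T -> R | measurable_fun setT f /\ forall x, 0 <= f x <= 1]].

End densities_and_kernels.

Section componentwise.
Context (M : nat) (Omega : 'I_M -> ptopologicalType) (R : realType).

(* The families below are indexed by theta^(-k), so a component update cannot
   depend on the component being updated other than as the current state. *)

(* Regular conditional distribution of the k-th component given the others. *)
Definition full_conditional (Pi : probability (borel (prod_space Omega)) R)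
    (k : 'I_M)
    (K : R.-pker (borel (compl_space Omega k)) ~> (borel (Omega k))) : Prop :=
  forall (C : set (borel (compl_space Omega k))) (B : set (borel (Omega k))),
    measurable C -> measurable B ->
    Pi [set theta : prod_space Omega | C (drop_comp k theta) /\ B (theta k)] =
    (\int[Pi]_(theta in [set theta : prod_space Omega | C (drop_comp k theta)])
       K (drop_comp k theta) B)%E.

Definition random_scan (lam : 'I_M -> R)
    (P : forall k, compl_space Omega k ->
      R.-pker (borel (Omega k)) ~> (borel (Omega k)))
    (PRS : R.-pker (borel (prod_space Omega)) ~> (borel (prod_space Omega))) :
    Prop :=
  forall (theta : prod_space Omega) (B : forall k, set (borel (Omega k))),
    (forall k, measurable (B k)) ->
    PRS theta (rectangle B) =
    (\sum_k (lam k)%:E * (P k (drop_comp k theta) (theta k) (B k) *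
                          \prod_(j | j != k) \d_(theta j : borel (Omega j)) (B j)))%E.

End componentwise.

(* Main.v *)
Require Import Defs.
From mathcomp Require Import measurable_realfun.

(** The point mass at the starting state is the obstruction. A componentwise
    accept-reject kernel leaves its component where it is whenever the proposal
    is rejected, so one random-scan step stays at [theta] with probability at
    least [c := 1 - \sum_k lam k * A_k(theta_k)], where [A_k] is the acceptance
    probability of component [k] ([random_scan_stay]). Always choosing to stay
    is one way of being at [theta] at time [t], hence the [t]-step kernel gives
    [[set theta]] mass at least [c ^ t] ([kernel_iter_stay]). The target has a
    density with respect to a measure that does not charge [[set theta]], so
    it gives this set mass zero, and testing the total variation distance
    against the indicator of [[set theta]] ([le_tv_dist]) yields the bound.

    Two points need care. The componentwise kernels are evaluated at the
    singletons [[set theta k]], whereas only [[set theta]] is assumed to be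
    Borel: the slice through [theta] along coordinate [k] is continuous and
    pulls [[set theta]] back to [[set theta k]] ([measurable_set1_comp]). Taking
    powers of the one-step bound requires [0 <= c], which holds because an
    acceptance probability is at most the total mass of the proposal
    ([accept_prob_le1]). *)

Set Implicit Arguments.
Unset Strict Implicit.
Unset Printing Implicit Defensive.
Local Open Scope classical_set_scope.
Local Open Scope ring_scope.

Lemma rectangle_set1 (M : nat) (Omega : 'I_M -> ptopologicalType)
    (theta : prod_space Omega) :
  rectangle (fun k => [set theta k]) = [set theta].
Proof.
apply/seteqP; split=> [x xt|x -> //]; apply: functional_extensionality_dep => k.
exact: xt.
Qed.

Lemma continuous_borel_measurable (S T : ptopologicalType) (f : S -> T) :
  continuous f -> measurable_fun setT (f : borel S -> borel T).
Proof.
move=> /continuousP cf; apply: (@measurability _ _ (borel S) (borel T) _ _ (@open T)) => //.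
move=> _ [U oU <-]; rewrite setTI; apply: sub_sigma_algebra; exact: cf.
Qed.

(** A Borel set of the product need not be a countable combination of
    rectangles, so [[set theta k]] is reached by pulling back along the slice
    that varies the [k]-th coordinate of [theta]. *)
Lemma measurable_set1_comp (M : nat) (Omega : 'I_M -> ptopologicalType)
    (theta : prod_space Omega) (k : 'I_M) :
  measurable ([set theta] : set (borel (prod_space Omega))) ->
  measurable ([set theta k] : set (borel (Omega k))).
Proof.
move=> mtheta.
pose slice : Omega k -> prod_space Omega := dfwith theta k.
have mslice : measurable_fun setT
    (slice : borel (Omega k) -> borel (prod_space Omega)).
  by apply: continuous_borel_measurable; exact: dfwith_continuous.
suff -> : [set theta k] = setT `&` slice @^-1` [set theta] by exact: mslice.
rewrite setTI; apply/seteqP; split=> x /=.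
  move=> ->; apply: functional_extensionality_dep => j; rewrite /slice.
  by case: dfwithP.
by move=> <-; rewrite /slice dfwithin.
Qed.

Section measures_and_kernels.
Context d (T : measurableType d) (R : realType).
Implicit Types mu nu : {measure set T -> \bar R}.

Lemma has_density_null nu mu (f : T -> R) (N : set T) :
  has_density nu mu f -> measurable N -> nu N = 0%E -> mu N = 0%E.
Proof.
move=> [mf _ muE] mN nuN; rewrite muE//; apply: null_set_integral => //.
by apply/measurable_EFinP; exact: measurable_funTS.
Qed.

Lemma le_tv_dist mu nu (A : set T) :
  measurable A -> (mu A - nu A <= tv_dist mu nu)%E.
Proof.
move=> mA; apply: ereal_sup_ubound; exists (\1_A).
  split; first exact: measurable_indic.
  by move=> x; rewrite indicE; case: (_ \in _); rewrite ?lexx ler01.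
by rewrite !integral_indic// !setIT.
Qed.

Lemma accept_prob_le1 nu (Q : R.-pker T ~> T) (q a : T -> T -> R)
    (P : R.-pker T ~> T) (x : T) :
  arb_kernel nu Q q a P -> accept_prob nu q a x <= 1.
Proof.
move=> [dens ma a01 _]; have [mq q0 Qq] := dens x.
have aq0 y : (0 <= (a x y * q x y)%:E)%E.
  by rewrite lee_fin mulr_ge0//; have /andP[] := a01 x y.
have le1 : (\int[nu]_y (a x y * q x y)%:E <= 1)%E.
  rewrite -(prob_kernel (s := Q) x) Qq//; apply: ge0_le_integral => //.
  - by apply/measurable_EFinP; apply: measurable_funM.
  - exact/measurable_EFinP.
  - by move=> y _; rewrite lee_fin ler_piMl//; have /andP[] := a01 x y.
have ge0 : (0 <= \int[nu]_y (a x y * q x y)%:E)%E by apply: integral_ge0.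
rewrite /accept_prob /Rintegral -lee_fin fineK//.
by rewrite ge0_fin_numE//; apply: le_lt_trans le1 _; rewrite ltry.
Qed.

(** Rejection alone contributes this much: the accepted part of the kernel can
    only add mass to the current state. *)
Lemma arb_kernel_stay nu (Q : R.-pker T ~> T) (q a : T -> T -> R)
    (P : R.-pker T ~> T) (x : T) :
  arb_kernel nu Q q a P -> measurable [set x] ->
  ((1 - accept_prob nu q a x)%:E <= P x [set x])%E.
Proof.
move=> [dens _ a01 PE] mx; have [_ q0 _] := dens x.
rewrite PE// diracE mem_set// mul1e leeDr//; apply: integral_ge0 => y _.
by rewrite lee_fin mulr_ge0//; have /andP[] := a01 x y.
Qed.

(** Among the trajectories that end at [x], keep only the constant one. *)
Lemma kernel_iter_stay (P : R.-pker T ~> T) (x : T) (c : R) (t : nat) :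
  measurable [set x] -> 0 <= c -> (c%:E <= P x [set x])%E ->
  ((c ^+ t)%:E <= kernel_iter P t x [set x])%E.
Proof.
move=> mx c0 cP; elim: t => [|t IHt].
  by rewrite expr0 /= /kdirac diracE mem_set.
have mK : measurable_fun setT (fun y => kernel_iter P t y [set x]).
  exact: measurable_kernel.
apply: (@le_trans _ _ (\int[P x]_(y in [set x]) kernel_iter P t y [set x])%E).
  rewrite (eq_integral (fun=> kernel_iter P t x [set x])); last first.
    by move=> y; rewrite inE => ->.
  by rewrite integral_cst// exprSr EFinM lee_pmul// lee_fin exprn_ge0.
by apply: ge0_subset_integral.
Qed.

End measures_and_kernels.

(** [[set theta]] is the rectangle with sides [[set theta k]]; on it the factors
    of the components that are not updated are all [1], so only the probability
    that the selected component stays put remains. *)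
Lemma random_scan_stay (M : nat) (Omega : 'I_M -> ptopologicalType)
    (R : realType) (nu : forall k, {measure set (borel (Omega k)) -> \bar R})
    (Q P : forall k, compl_space Omega k ->
      R.-pker (borel (Omega k)) ~> (borel (Omega k)))
    (q a : forall k, compl_space Omega k ->
      borel (Omega k) -> borel (Omega k) -> R)
    (lam : 'I_M -> R)
    (PRS : R.-pker (borel (prod_space Omega)) ~> (borel (prod_space Omega)))
    (theta : prod_space Omega) :
  (forall k eta, arb_kernel (nu k) (Q k eta) (q k eta) (a k eta) (P k eta)) ->
  (forall k, 0 <= lam k) -> \sum_k lam k = 1 -> random_scan lam P PRS ->
  measurable ([set theta] : set (borel (prod_space Omega))) ->
  ((1 - \sum_k lam k * accept_prob (nu k) (q k (drop_comp k theta))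
           (a k (drop_comp k theta)) (theta k))%:E
   <= PRS theta [set theta])%E.
Proof.
move=> arbP lam0 lam1 PRSE mtheta.
have mcomp k := measurable_set1_comp (k := k) mtheta.
rewrite -rectangle_set1 PRSE// -[in leLHS]lam1 -sumrB -sumEFin; apply: lee_sum => k _.
rewrite big1 => [|j _]; last by rewrite diracE mem_set.
rewrite mule1 -{1}(mulr1 (lam k)) -mulrBr EFinM lee_wpmul2l ?lee_fin//.
exact: arb_kernel_stay (arbP _ _) (mcomp k).
Qed.

Theorem theorem6 (R : realType) (M : nat) (Omega : 'I_M -> ptopologicalType)
  (Theta_ : forall k, set (Omega k))
  (lambda : {sigma_finite_measure set (borel (prod_space Omega)) -> \bar R})
  (Pi : probability (borel (prod_space Omega)) R)
  (pi_ : borel (prod_space Omega) -> R)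
  (Theta0 : rectangle Theta_ !=set0)
  (mTheta : measurable (rectangle Theta_ : set (borel (prod_space Omega))))
  (PiTheta : Pi (rectangle Theta_) = 1%E)
  (Pi_density : has_density lambda Pi pi_)
  (pi_supp : forall theta, rectangle Theta_ theta <-> 0 < pi_ theta)
  (Theta_pt : forall theta : borel (prod_space Omega), rectangle Theta_ theta ->
     measurable [set theta] /\ lambda [set theta] = 0%E)
  (lambda_open : forall U : set (prod_space Omega), open U -> U !=set0 ->
     U `<=` rectangle Theta_ -> (0 < lambda U)%E)
  (nu : forall k, {measure set (borel (Omega k)) -> \bar R})
  (Pic : forall k, R.-pker (borel (compl_space Omega k)) ~> (borel (Omega k)))
  (pic : forall k, compl_space Omega k -> borel (Omega k) -> R)
  (Pic_cond : forall k, full_conditional Pi (Pic k))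
  (Pic_density : forall k theta, rectangle Theta_ theta ->
     has_density (nu k) (Pic k (drop_comp k theta)) (pic k (drop_comp k theta)))
  (Q : forall k, compl_space Omega k ->
     R.-pker (borel (Omega k)) ~> (borel (Omega k)))
  (q a : forall k, compl_space Omega k ->
     borel (Omega k) -> borel (Omega k) -> R)
  (P : forall k, compl_space Omega k ->
     R.-pker (borel (Omega k)) ~> (borel (Omega k)))
  (P_arb : forall k (eta : compl_space Omega k),
     arb_kernel (nu k) (Q k eta) (q k eta) (a k eta) (P k eta))
  (P_inv : forall k theta, rectangle Theta_ theta ->
     invariant_measure (Pic k (drop_comp k theta)) (P k (drop_comp k theta)))
  (not_all_gibbs : exists k, ~ (forall theta, rectangle Theta_ theta ->
     gibbs_update (nu k) (Pic k (drop_comp k theta))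
       (Q k (drop_comp k theta)) (q k (drop_comp k theta)) (a k (drop_comp k theta))))
  (lam : 'I_M -> R)
  (lam01 : forall k, 0 < lam k < 1)
  (lam_sum : \sum_k lam k = 1)
  (PRS : R.-pker (borel (prod_space Omega)) ~> (borel (prod_space Omega)))
  (PRS_def : random_scan lam P PRS) :
  forall (theta : prod_space Omega), rectangle Theta_ theta ->
  forall t : nat, (0 < t)%N ->
  (((1 - \sum_k lam k * accept_prob (nu k) (q k (drop_comp k theta))
           (a k (drop_comp k theta)) (theta k)) ^+ t)%:E
   <= tv_dist (kernel_iter PRS t theta) Pi)%E.
Proof.
move=> theta Ttheta t _.
have [mtheta lambda0] := Theta_pt _ Ttheta.
have lam0 k : 0 <= lam k by have /andP[/ltW] := lam01 k.
have Pi0 := has_density_null Pi_density mtheta lambda0.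
have stay := random_scan_stay P_arb lam0 lam_sum PRS_def mtheta.
apply: le_trans (le_tv_dist _ Pi mtheta).
rewrite Pi0 sube0; apply: kernel_iter_stay => //.
rewrite subr_ge0 -lam_sum; apply: ler_sum => k _.
by rewrite ler_piMr//; apply: accept_prob_le1 (P_arb _ _).
Qed.
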